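(* Let $k \ge 0$ and $r \ge k+2$ be integers, and let $G$ be a connected graph with $\alpha_{k,L}(G) \le r-1$. Then \[ \alpha_k(G) \le \gamma_{r+k-1}(G). \]
   Context: All graphs are finite, simple and undirected. For an integer $k \ge 0$, a set $S \subseteq V(G)$ is $k$-independent if the induced subgraph $G[S]$ has maximum degree at most $k$; $\alpha_k(G)$ is the maximum cardinality of a $k$-independent set of $G$. The local $k$-independence number is $\alpha_{k,L}(G) = \max_{v \in V(G)} \alpha_k(G[N(v)])$, where $N(v)$ is the open neighborhood of $v$. For an integer $j \ge 1$, a $j$-dominating set of $G$ is a set $S \subseteq V(G)$ such that every vertex not in $S$ has at least $j$ neighbors in $S$; $\gamma_j(G)$ is the minimum cardinality of a $j$-dominating set of $G$. *)

(* Defs.v *)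
From mathcomp Require Import all_boot.

Set Implicit Arguments.
Unset Strict Implicit.
Unset Printing Implicit Defensive.

Record sgraph := SGraph {
  vertex :> finType;
  adj : rel vertex;
  adj_sym : symmetric adj;
  adj_irrefl : irreflexive adj }.

Definition connected (G : sgraph) : Prop := forall x y : G, connect (@adj G) x y.

Definition nbhd (G : sgraph) (v : G) : {set G} := [set w | adj v w].

Definition max_degree (G : sgraph) : nat := \max_(v : G) #|nbhd v|.

Section Induced.
Variables (G : sgraph) (U : {set G}).

Definition induced_adj : rel {x : G | x \in U} := fun x y => adj (val x) (val y).

Lemma induced_sym : symmetric induced_adj.
Proof. by move=> x y; apply: adj_sym. Qed.

Lemma induced_irrefl : irreflexive induced_adj.
Proof. by move=> x; apply: adj_irrefl. Qed.

Definition induced : sgraph := SGraph induced_sym induced_irrefl.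

End Induced.

Definition k_independent (G : sgraph) (k : nat) (S : {set G}) : bool :=
  max_degree (induced S) <= k.

Definition alpha (k : nat) (G : sgraph) : nat :=
  \max_(S : {set G} | k_independent k S) #|S|.

Definition local_alpha (k : nat) (G : sgraph) : nat :=
  \max_(v : G) alpha k (induced (nbhd v)).

Definition j_dominating (G : sgraph) (j : nat) (S : {set G}) : bool :=
  [forall v, (v \notin S) ==> (j <= #|nbhd v :&: S|)].

(* The starting point [set: G] of the minimum is vacuously j-dominating. *)
Definition gamma (j : nat) (G : sgraph) : nat :=
  #|[arg min_(S < [set: G] | j_dominating j S) #|S|]|.

(* Main.v *)
Require Import Defs.
From mathcomp Require Import all_boot.

(** Let [S] be [k]-independent and [D] be [(r + k - 1)]-dominating, and count the
    edges between [S :\: D] and [D :\: S]. A vertex of [S :\: D] has at least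
    [r + k - 1] neighbours in [D], at most [k] of them in [S], hence at least
    [r - 1] in [D :\: S]. The neighbours in [S] of any vertex [w] form a
    [k]-independent set of the graph induced on the neighbourhood of [w], so
    there are at most [r - 1] of them. As [r - 1] is positive,
    [#|S :\: D| <= #|D :\: S|]. *)

Lemma card_preim_val (T : finType) (U A : {set T}) :
  #|[set x : {x : T | x \in U} | val x \in A]| = #|A :&: U|.
Proof.
rewrite -(card_imset _ val_inj); apply: eq_card => y; apply/imsetP/idP.
- by case=> x; rewrite inE => xA ->; rewrite inE xA (valP x).
- by rewrite inE => /andP[yA yU]; exists (exist _ y yU); rewrite ?inE.
Qed.

Lemma card_nbhd_induced (G : sgraph) (U : {set G}) (x : induced U) :
  #|nbhd x| = #|nbhd (val x) :&: U|.
Proof.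
by rewrite -card_preim_val; apply: eq_card => y; rewrite !inE.
Qed.

(** Counting degrees inside [G] itself keeps the subtype behind [induced S] out of later
    arguments. *)
Lemma k_independentP (G : sgraph) (k : nat) (S : {set G}) :
  reflect {in S, forall v, #|nbhd v :&: S| <= k} (k_independent k S).
Proof.
rewrite /k_independent /max_degree.
apply: (iffP (bigmax_leqP _ _ _)) => [degS v vS | degS x _].
- by have := degS (exist _ v vS) isT; rewrite card_nbhd_induced.
- by rewrite card_nbhd_induced; apply: degS (valP x).
Qed.

Arguments k_independentP {G k S}.

(** Restricting to [U] only deletes vertices, so no degree within [S] grows. *)
Lemma k_independent_induced (G : sgraph) (k : nat) (S U : {set G}) :
  k_independent k S ->
  k_independent k ([set x | val x \in S] : {set induced U}).
Proof.
move/k_independentP=> degS; apply/k_independentP=> x; rewrite inE => xS.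
apply: leq_trans (degS _ xS).
rewrite -(card_imset _ val_inj); apply/subset_leq_card/subsetP=> _ /imsetP[y + ->].
by rewrite !inE.
Qed.

Lemma leq_card_nbhd_local_alpha (G : sgraph) (k : nat) (S : {set G}) (v : G) :
  k_independent k S -> #|S :&: nbhd v| <= local_alpha k G.
Proof.
move=> indS; apply: leq_trans (leq_bigmax v).
rewrite -card_preim_val.
exact: (leq_bigmax_cond _ (k_independent_induced _ _ _ (nbhd v) indS)).
Qed.

(** Double counting: both sides count the adjacent pairs in [A] times [B]. *)
Lemma sum_card_nbhd (G : sgraph) (A B : {set G}) :
  \sum_(a in A) #|nbhd a :&: B| = \sum_(b in B) #|A :&: nbhd b|.
Proof.
have cardE (P Q : pred G) : #|[set x | P x && Q x]| = \sum_(x | P x) Q x.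
  by rewrite cardsE -sum1_card big_mkcondr; apply: eq_bigr => x _; case: (Q x).
have lE a : #|nbhd a :&: B| = \sum_(b in B) adj a b.
  by rewrite -cardE; apply: eq_card => b; rewrite !inE andbC.
have rE b : #|A :&: nbhd b| = \sum_(a in A) adj a b.
  by rewrite -cardE; apply: eq_card => a; rewrite !inE adj_sym.
by under eq_bigr do rewrite lE; rewrite exchange_big; under [RHS]eq_bigr do rewrite rE.
Qed.

Lemma j_dominating_gamma (G : sgraph) (j : nat) :
  exists2 D : {set G}, j_dominating j D & #|D| = gamma j G.
Proof.
rewrite /gamma; case: arg_minnP => [|D domD _]; last by exists D.
by apply/forallP=> v; rewrite inE.
Qed.

Theorem theorem3 (k r : nat) (G : sgraph) :
  k + 2 <= r -> connected G -> local_alpha k G <= r - 1 ->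
  alpha k G <= gamma (r + k - 1) G.
Proof.
move=> le_k2r _ localG; apply/bigmax_leqP=> S indS.
have [D /forallP domD <-] := j_dominating_gamma G (r + k - 1).
have r_gt1 : 1 < r by rewrite (leq_trans _ le_k2r) ?leq_addl.
(* Cancel the common part [S :&: D]; scaling by [r - 1] then turns both cardinals into constant
   sums, to be compared through the edge count. *)
rewrite -(cardsID D S) -(cardsID S D) setIC leq_add2l.
rewrite -(leq_pmul2r (_ : 0 < r - 1)) ?subn_gt0 // -!sum_nat_const.
apply: (@leq_trans (\sum_(a in S :\: D) #|nbhd a :&: (D :\: S)|)).
- apply: leq_sum => a /setDP[aS aD].
  have := implyP (domD a) aD; rewrite -(cardsID S (nbhd a :&: D)) setIDA.
  have degS : #|nbhd a :&: D :&: S| <= k.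
    apply: leq_trans (k_independentP indS a aS).
    by rewrite subset_leq_card // setSI // subsetIl.
  (* As [r] is positive, [r + k - 1] is [k + (r - 1)] despite truncated subtraction. *)
  rewrite addnC -addnBA ?(ltnW r_gt1) // => /leq_trans le_rk.
  by rewrite -(leq_add2l k) le_rk // leq_add2r.
- rewrite sum_card_nbhd; apply: leq_sum => b _.
  apply: leq_trans localG; apply: leq_trans (leq_card_nbhd_local_alpha _ _ _ b indS).
  by rewrite subset_leq_card // setSI // subsetDl.
Qed.
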